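(* Let $\varphi:\mathbb{R}^n\to\overline{\mathbb{R}}$ be a lower semicontinuous (l.s.c.) and prox-bounded function with $\bar x\in\operatorname{dom}\varphi$ and $\bar v\in\partial\varphi(\bar x)$. The following assertions are equivalent: (i) $\varphi$ is variationally convex at $\bar x$ for $\bar v$. (ii) $\varphi$ is prox-regular at $\bar x$ for $\bar v$, and the Moreau envelope $e_\lambda\varphi$ is locally convex around $\bar x+\lambda\bar v$ for all sufficiently small $\lambda>0$.
   Context: Conventions: $\overline{\mathbb{R}}:=(-\infty,\infty]$; every extended-real-valued function is assumed proper, i.e. $\operatorname{dom}\varphi:=\{x\mid\varphi(x)<\infty\}\neq\emptyset$. $\mathbb{B}_\epsilon(a)$ is the closed ball with center $a$ and radius $\epsilon$. Subdifferentials: for $\bar x\in\operatorname{dom}\varphi$, the regular subdifferential is $$\widehat\partial\varphi(\bar x)=\Big\{v\in\mathbb{R}^n\;\Big|\;\liminf_{x\to\bar x}\frac{\varphi(x)-\varphi(\bar x)-\langle v,x-\bar x\rangle}{\|x-\bar x\|}\ge 0\Big\},$$ and the limiting subdifferential $\partial\varphi(\bar x)$ is the set of all $v$ for which there are $x_k\to\bar x$ with $\varphi(x_k)\to\varphi(\bar x)$ and $v_k\in\widehat\partial\varphi(x_k)$ with $v_k\to v$. Set $\operatorname{gph}\partial\varphi=\{(x,v)\mid v\in\partial\varphi(x)\}$. Variational convexity: an l.s.c. function $\varphi$ is variationally convex at $\bar x$ for $\bar v\in\partial\varphi(\bar x)$ if for some convex neighborhood $U\times V$ of $(\bar x,\bar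 v)$ there exist an l.s.c. convex function $\psi\le\varphi$ on $U$ and a number $\epsilon>0$ such that $$(U_\epsilon\times V)\cap\operatorname{gph}\partial\varphi=(U\times V)\cap\operatorname{gph}\partial\psi\quad\text{and}\quad\varphi(x)=\psi(x)\ \text{at the common elements }(x,v),$$ where $U_\epsilon:=\{x\in U\mid\varphi(x)<\varphi(\bar x)+\epsilon\}$. Prox-regularity: an l.s.c. function $\varphi$ is prox-regular at $\bar x\in\operatorname{dom}\varphi$ for $\bar v\in\partial\varphi(\bar x)$ if there exist $\epsilon>0$ and $r\ge0$ such that $\varphi(x)\ge\varphi(u)+\langle v,x-u\rangle-\frac r2\|x-u\|^2$ for all $x\in\mathbb{B}_\epsilon(\bar x)$ and all $(u,v)\in\operatorname{gph}\partial\varphi\cap(\mathbb{B}_\epsilon(\bar x)\times\mathbb{B}_\epsilon(\bar v))$ with $\varphi(u)<\varphi(\bar x)+\epsilon$. Moreau envelope: $e_\lambda\varphi(x):=\inf_{y\in\mathbb{R}^n}\{\varphi(y)+\frac1{2\lambda}\|y-x\|^2\}$ for $\lambda>0$. The function $\varphi$ is prox-bounded if there is $\lambda>0$ with $e_\lambda\varphi(x)>-\infty$ for some $x\in\mathbb{R}^n$. A function is locally convex around a point if it is convex on some convex neighborhood of that point. *)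

(* Defs.v *)
From HB Require Import structures.
From mathcomp Require Import all_boot all_order all_algebra.
From mathcomp Require Import all_classical all_reals all_analysis.

Set Implicit Arguments.
Unset Strict Implicit.
Unset Printing Implicit Defensive.

Import Order.TTheory GRing.Theory Num.Theory.
Import numFieldNormedType.Exports.

Local Open Scope classical_set_scope.
Local Open Scope ring_scope.

Section VariationalAnalysis.
Context {R : realType} {n : nat}.
Local Notation E := 'rV[R]_n.
Implicit Types (f phi psi : E -> \bar R) (x u v : E) (D : set E).

(* The library's norm `|x| on row vectors is the sup norm, hence the Euclidean
   inner product and norm below; both norms induce the library's topology. *)
Definition dot u v : R := \sum_(i < n) u 0 i * v 0 i.

Definition enorm u : R := Num.sqrt (dot u u).

Definition eball (a : E) (r : R) : set E := [set x | enorm (x - a) <= r].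

Local Open Scope ereal_scope.

Definition edom f : set E := [set x | f x < +oo].

Definition proper_fun f : Prop := (forall x, -oo < f x) /\ edom f !=set0.

(* The library's [convex_function] is restricted to real-valued functions. *)
Definition econvex_on D f : Prop :=
  forall x y (t : R), D x -> D y -> (0 < t < 1)%R ->
    f (t *: x + (1 - t) *: y)%R <= t%:E * f x + (1 - t)%:E * f y.

Definition locally_convex_around f x : Prop :=
  exists U : set E, [/\ nbhs x U, convex_set U & econvex_on U f].

(* Both subdifferentials are empty outside the domain. *)
Definition regular_subdiff f (xbar : E) : set E :=
  [set v | edom f xbar /\
    0 <= limf_einf (fun x => (f x - f xbar - (dot v (x - xbar)%R)%:E)
                             * ((enorm (x - xbar))^-1)%:E) xbar^'].

Definition limiting_subdiff f (xbar : E) : set E :=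
  [set v | edom f xbar /\
    exists x_ v_ : nat -> E,
      [/\ x_ k @[k --> \oo] --> xbar,
          f (x_ k) @[k --> \oo] --> f xbar,
          (forall k, regular_subdiff f (x_ k) (v_ k)) &
          v_ k @[k --> \oo] --> v]].

Definition gph (S : E -> set E) : set (E * E) := [set xv | S xv.1 xv.2].

(* Presupposes that [phi] is lower semicontinuous and [vbar] a limiting subgradient
   of [phi] at [xbar].  The function [psi] is defined, proper, l.s.c. and convex
   on the whole space, while psi <= phi is only required on U. *)
Definition variationally_convex phi (xbar vbar : E) : Prop :=
  exists U V : set E,
    [/\ nbhs xbar U, convex_set U, nbhs vbar V & convex_set V] /\
  exists (psi : E -> \bar R) (eps : R),
    let Ueps := [set x | U x /\ phi x < phi xbar + eps%:E] in
    let common := (Ueps `*` V) `&` gph (limiting_subdiff phi) in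
    [/\ [/\ proper_fun psi, lower_semicontinuous psi & econvex_on setT psi],
        (forall x, U x -> psi x <= phi x),
        (0 < eps)%R,
        common = (U `*` V) `&` gph (limiting_subdiff psi) &
        forall x v, common (x, v) -> phi x = psi x].

(* Same standing assumptions on [phi], [xbar] and [vbar] as above. *)
Definition prox_regular phi (xbar vbar : E) : Prop :=
  exists eps r : R, [/\ (0 < eps)%R, (0 <= r)%R &
    forall x u v,
      eball xbar eps x ->
      (gph (limiting_subdiff phi) `&` (eball xbar eps `*` eball vbar eps))
        (u, v) ->
      phi u < phi xbar + eps%:E ->
      phi u + (dot v (x - u) - r / 2 * enorm (x - u) ^+ 2)%:E <= phi x].

Definition moreau_envelope (lambda : R) f (x : E) : \bar R :=
  ereal_inf (range (fun y : E =>
    f y + ((2 * lambda)^-1 * enorm (y - x) ^+ 2)%:E)).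

Definition prox_bounded f : Prop :=
  exists2 lambda : R, (0 < lambda)%R &
    exists x : E, -oo < moreau_envelope lambda f x.

End VariationalAnalysis.

(* Main.v *)
(** Write [x], [v] for the reference pair and [s = 1 / (2 lambda)].  Prox-regularity
    and prox-boundedness together make every subgradient [v'] at [u] near
    [(x, v)] global up to a fixed quadratic:
    phi >= phi(u) + <v', . - u> - K |. - u|^2 everywhere.  When [K <= s] this says
    that [u] attains the Moreau envelope at [u + lambda v'].

    If phi is variationally convex with convex minorant psi, the proximal points
    of psi at points near [x + lambda v] give pairs of the common graph, so they
    are also proximal points of phi: the two envelopes coincide near
    [x + lambda v], and that of psi is convex.

    Conversely, take one small lambda whose envelope [e] is convex near
    [x + lambda v].  At [u + lambda v'] the function [e] is touched from above by
    a quadratic of gradient [v'], so by convexity [v'] is a subgradient of [e]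
    there.  Evaluating this at [y + lambda v'], where
    e(y + lambda v') <= phi(y) + (lambda / 2) |v'|^2, gives the genuine subgradient
    inequality phi(y) >= phi(u) + <v', y - u> for [y] near [x].  The supremum of
    these affine functions is the required psi; its graph near [(x, v)] contains
    nothing else because every [z] near [x + lambda v] is [u + lambda v'] for some
    such pair, and the subdifferential of psi is monotone. *)

Require Import Defs.
From mathcomp Require Import all_boot all_order all_algebra.
From mathcomp Require Import all_classical all_reals all_analysis.
From mathcomp Require Import ring lra.

Set Implicit Arguments.
Unset Strict Implicit.
Unset Printing Implicit Defensive.

Import Order.TTheory GRing.Theory Num.Theory.
Import numFieldNormedType.Exports.
Local Open Scope classical_set_scope.
Local Open Scope ring_scope.

(** * Euclidean geometry on row vectors *)

Section Euclidean.
Context {R : realType} {n : nat}.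
Local Notation E := 'rV[R]_n.
Implicit Types (u v w x y : E).

Lemma dotC u v : dot u v = dot v u.
Proof. by apply: eq_bigr => i _; rewrite mulrC. Qed.

Lemma dotDl u v w : dot (u + v) w = dot u w + dot v w.
Proof. by rewrite -big_split; apply: eq_bigr => i _; rewrite mxE mulrDl. Qed.

Lemma dotZl (a : R) u w : dot (a *: u) w = a * dot u w.
Proof. by rewrite /dot mulr_sumr; apply: eq_bigr => i _; rewrite mxE mulrA. Qed.

Lemma dotNl u w : dot (- u) w = - dot u w.
Proof. by rewrite -scaleN1r dotZl mulN1r. Qed.

Lemma dotDr u v w : dot w (u + v) = dot w u + dot w v.
Proof. by rewrite dotC dotDl !(dotC w). Qed.

Lemma dotZr (a : R) u w : dot w (a *: u) = a * dot w u.
Proof. by rewrite dotC dotZl dotC. Qed.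

Lemma dotNr u w : dot w (- u) = - dot w u.
Proof. by rewrite dotC dotNl dotC. Qed.

Definition dotE := (dotDl, dotDr, dotNl, dotNr, dotZl, dotZr).

Lemma dot0r w : dot w 0 = 0.
Proof. by rewrite -(scale0r 0) dotZr mul0r. Qed.

Lemma dot_ge0 u : 0 <= dot u u.
Proof. by apply: sumr_ge0 => i _; rewrite -expr2 sqr_ge0. Qed.

Lemma enorm_ge0 u : 0 <= enorm u.
Proof. exact: sqrtr_ge0. Qed.

Lemma sqr_enorm u : enorm u ^+ 2 = dot u u.
Proof. by rewrite sqr_sqrtr// dot_ge0. Qed.

Lemma coord_le_enorm u i : `|u 0 i| <= enorm u.
Proof.
rewrite -sqrtr_sqr ler_sqrt ?dot_ge0// /dot (bigD1 i)//= -expr2 lerDl.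
by apply: sumr_ge0 => j _; rewrite -expr2 sqr_ge0.
Qed.

Lemma enorm_eq0 u : (enorm u == 0) = (u == 0).
Proof.
apply/eqP/eqP => [u0|->].
  apply/rowP => i; rewrite mxE; apply/eqP.
  by rewrite -normr_le0 -u0 coord_le_enorm.
by rewrite /enorm dot0r sqrtr0.
Qed.

Lemma enorm_gt0 u : (0 < enorm u) = (u != 0).
Proof. by rewrite lt0r enorm_eq0 enorm_ge0 andbT. Qed.

Lemma enorm0 : enorm (0 : E) = 0.
Proof. by rewrite /enorm dot0r sqrtr0. Qed.

Lemma enormZ (a : R) u : enorm (a *: u) = `|a| * enorm u.
Proof.
by rewrite /enorm !dotE mulrA -expr2 sqrtrM ?sqr_ge0// sqrtr_sqr.
Qed.

Lemma enormN u : enorm (- u) = enorm u.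
Proof. by rewrite -scaleN1r enormZ normrN1 mul1r. Qed.

(** Cauchy-Schwarz: expand the square of [enorm v *: u - enorm u *: v], which is nonnegative, and
    cancel the product of the two norms. *)
Lemma dot_le_enorm u v : dot u v <= enorm u * enorm v.
Proof.
have [->|v0] := eqVneq v 0.
  by rewrite dot0r mulr_ge0 ?enorm_ge0.
have Nv : 0 < enorm v by rewrite enorm_gt0.
have [->|u0] := eqVneq u 0.
  by rewrite dotC dot0r mulr_ge0 ?enorm_ge0.
have Nu : 0 < enorm u by rewrite enorm_gt0.
have := dot_ge0 (enorm v *: u - enorm u *: v).
rewrite !dotE (dotC v u) -!sqr_enorm => h.
rewrite -(ler_pM2l (mulr_gt0 Nu Nv)); nra.
Qed.

Lemma ler_enormD u v : enorm (u + v) <= enorm u + enorm v.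
Proof.
rewrite -(ler_pXn2r (n := 2))// ?nnegrE ?addr_ge0 ?enorm_ge0//.
rewrite sqr_enorm !dotE (dotC v u) -!sqr_enorm.
by have := dot_le_enorm u v; nra.
Qed.

Lemma ler_dist_enormD w u v : enorm (u - v) <= enorm (u - w) + enorm (w - v).
Proof. by rewrite -{1}(subrK w u) -addrA; exact: ler_enormD. Qed.

Lemma cvg_dot (T : Type) (F : set_system T) (FF : Filter F) (f g : T -> E) u v :
  f @ F --> u -> g @ F --> v -> dot (f t) (g t) @[t --> F] --> dot u v.
Proof.
move=> fu gv; rewrite /dot; apply: cvg_big => [|i _].
  by move=> z; apply: cvgD; [exact: cvg_fst|exact: cvg_snd].
apply: cvgM; first exact: (cvg_comp _ _ fu (@coord_continuous R 1 n 0 i u)).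
exact: (cvg_comp _ _ gv (@coord_continuous R 1 n 0 i v)).
Qed.

(** The squared Euclidean distance to [u] is continuous for the sup-norm topology and vanishes at
    [u]. *)
Lemma nbhs_eball u (r : R) : 0 < r -> nbhs u (eball u r).
Proof.
move=> r0; have cv : (fun x : E => x - u) @ nbhs u --> u - u.
  by apply: cvgB => //; exact: cvg_cst.
have cu := cvg_dot (nbhs_filter u) cv cv.
rewrite subrr dot0r in cu.
have := cvgr_lt _ cu _ (exprn_gt0 2 r0) => /(_ (nbhs_filter u)).
apply: filterS => x /= xr.
by rewrite /eball/= -(ler_pXn2r (n := 2))// ?nnegrE ?enorm_ge0 ?ltW// sqr_enorm.
Qed.

(** Coordinates are bounded by [enorm]; halving the radius fits a closed Euclidean ball into an open
    sup-norm ball. *)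
Lemma nbhs_eballP u (U : set E) : nbhs u U ->
  exists2 r : R, 0 < r & eball u r `<=` U.
Proof.
move=> /nbhs_ballP[e /= e0 eU]; exists (e / 2); first by rewrite divr_gt0.
move=> x xr; apply: eU; split=> // i j; rewrite (ord1 i).
rewrite /ball/= -opprB normrN; have := coord_le_enorm (x - u) j.
rewrite !mxE => h; apply: (le_lt_trans h); apply: (le_lt_trans xr).
by rewrite ltr_pdivrMr// ltr_pMr// ltr1n.
Qed.

Lemma eball_conv u (r t : R) x y : 0 <= t <= 1 ->
  eball u r x -> eball u r y -> eball u r (t *: x + (1 - t) *: y).
Proof.
move=> /andP[t0 t1] xr yr; rewrite /eball/=.
rewrite (_ : _ - u = t *: (x - u) + (1 - t) *: (y - u)); last first.
  by apply/rowP => i; rewrite !mxE; ring.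
apply: (le_trans (ler_enormD _ _)); rewrite !enormZ !ger0_norm ?subr_ge0//.
rewrite /eball/= in xr yr; nra.
Qed.

Lemma convex_eball u (r : R) : convex_set (eball u r).
Proof.
move=> x y l /[!inE] xr yr.
apply: (@eball_conv u r l%:num x y) => //.
by apply/andP; split.
Qed.

End Euclidean.

(** * Subgradients, quadratic supports and lower semicontinuity *)

Section Subgradients.
Context {R : realType} {n : nat}.
Local Notation E := 'rV[R]_n.
Implicit Types (f g : E -> \bar R) (u v w x y z : E) (a b c K : R).

Lemma EFin_le_of_fin (X : \bar R) c :
  (-oo < X)%E -> (forall b, X = b%:E -> c <= b) -> (c%:E <= X)%E.
Proof.
by case: X => [b _ /(_ b erefl)|_ _|]; rewrite ?lee_fin ?leey.
Qed.

Lemma edom_fin f x : proper_fun f -> edom f x -> exists a, f x = a%:E.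
Proof.
by move=> [fNy _]; rewrite /edom/=; have := fNy x; case: (f x) => // a; exists a.
Qed.

(** Multiplying by the positive [enorm (x - u)] removes the difference quotient from the lower
    limit. The resulting inequality is trivial at [x = u], so punctured neighborhoods become full
    ones. *)
Lemma regular_subdiffP f u v a : (forall x, (-oo < f x)%E) -> f u = a%:E ->
  regular_subdiff f u v <->
  forall eta : R, 0 < eta -> \forall x \near u,
    ((a + dot v (x - u) - eta * enorm (x - u))%:E <= f x)%E.
Proof.
move=> fNy fu.
split=> [[_]|h].
  rewrite limf_einfE => h eta eta0.
  have /ereal_sup_gt[_ [A nA <-] hA] : ((- eta)%:E <
      ereal_sup [set ereal_inf ((fun x => (f x - f u - (dot v (x - u))%:E) *
        ((enorm (x - u))^-1)%:E) @` V) | V in u^'])%E.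
    by apply: (lt_le_trans _ h); rewrite lte_fin oppr_lt0.
  move: nA; rewrite /dnbhs /within/=; apply: filterS => x xA.
  have [->|xu] := eqVneq x u.
    by rewrite fu subrr dot0r enorm0 mulr0 subr0 addr0.
  have := lt_le_trans hA (ereal_inf_lbound (ex_intro2 _ _ x (xA xu) erefl)).
  move=> /= hx; apply: EFin_le_of_fin => // b fx.
  move: hx; rewrite fx fu -!EFinB -EFinM lte_fin ltr_pdivlMr ?enorm_gt0 ?subr_eq0//.
  by move=> hx; lra.
split; first by rewrite /edom/= fu ltry.
rewrite limf_einfE; apply/lee_addgt0Pr => eta eta0.
pose A := [set x : E | x != u /\
  ((a + dot v (x - u) - eta * enorm (x - u))%:E <= f x)%E].
set S := ereal_sup _.
have hS : ((- eta)%:E <= S)%E.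
  apply: le_trans (ereal_sup_ubound _); last first.
    exists A => //; rewrite /dnbhs /within/=.
    by apply: filterS (h _ eta0) => x hx xu; split.
  apply: le_ereal_inf_tmp => _ [x [xu hx] <-].
  have N0 : 0 < enorm (x - u) by rewrite enorm_gt0 subr_eq0.
  rewrite fu; move: hx (fNy x); case: (f x) => [b||]//.
    rewrite lee_fin => hx _.
    rewrite -!EFinB -EFinM lee_fin ler_pdivlMr//; lra.
  by move=> _ _; rewrite /= gt0_mulye ?lte_fin ?invr_gt0// leey.
have := leeD2r eta%:E hS; rewrite -EFinD addNr; exact.
Qed.

(** With [K = 0] this is the convex subgradient inequality; with [K = 1 / (2 l)] it
    says that [u] minimizes [f + |. - z|^2 / (2 l)] for [z = u + l *: v]. *)
Definition quad_support f K a u v : Prop :=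
  f u = a%:E /\
  forall x, ((a + dot v (x - u) - K * dot (x - u) (x - u))%:E <= f x)%E.

Lemma quad_supportW f K K' a u v : K <= K' ->
  quad_support f K a u v -> quad_support f K' a u v.
Proof.
move=> KK' [fu h]; split=> // x; apply: le_trans (h x).
by rewrite lee_fin lerD2l lerN2 ler_wpM2r ?dot_ge0.
Qed.

Lemma quad_support_real f K a u v : quad_support f K a u v ->
  forall x b, (f x <= b%:E)%E ->
    a + dot v (x - u) - K * dot (x - u) (x - u) <= b.
Proof. by move=> [_ h] x b /(le_trans (h x)); rewrite lee_fin. Qed.

(** The quadratic term is at most [eta * enorm (x - u)] once [enorm (x - u) <= eta / (|K| + 1)]. *)
Lemma quad_support_regular f K a u v :
  (forall x, (-oo < f x)%E) -> quad_support f K a u v -> regular_subdiff f u v.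
Proof.
move=> fNy [fu h]; apply/(regular_subdiffP _ fNy fu) => eta eta0.
have K0 : 0 < `|K| + 1 by rewrite ltr_wpDl.
have := nbhs_eball u (divr_gt0 eta0 K0); apply: filterS => x.
rewrite /eball/= ler_pdivlMr// => hx; apply: le_trans (h x).
rewrite lee_fin lerD2l lerN2 -sqr_enorm expr2 mulrA ler_wpM2r ?enorm_ge0//.
apply: le_trans hx; rewrite mulrC ler_wpM2l ?enorm_ge0//.
by rewrite (le_trans (ler_norm K))// lerDl.
Qed.

Lemma regular_limiting f u v : regular_subdiff f u v -> limiting_subdiff f u v.
Proof.
move=> h; split; first by case: h.
by exists (fun=> u), (fun=> v); split=> //; exact: cvg_cst.
Qed.

Lemma quad_support_limiting f K a u v :
  (forall x, (-oo < f x)%E) -> quad_support f K a u v -> limiting_subdiff f u v.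
Proof. by move=> fNy /(quad_support_regular fNy)/regular_limiting. Qed.

(** The local inequality is applied at [t *: x + (1 - t) *: u] with [t] small enough to stay in its
    ball. Convexity bounds the value there from above, and dividing by [t] gives the inequality at
    [x] up to [eta]. *)
Lemma convex_regular_subdiff f u v a : (forall x, (-oo < f x)%E) ->
  econvex_on setT f -> f u = a%:E -> regular_subdiff f u v ->
  quad_support f 0 a u v.
Proof.
move=> fNy fc fu /(regular_subdiffP _ fNy fu) h; split=> // x.
rewrite mul0r subr0; apply: EFin_le_of_fin => // b fx.
have [xu|xu] := eqVneq x u.
  by move: fx; rewrite xu fu subrr dot0r addr0 => -[->].
have N0 : 0 < enorm (x - u) by rewrite enorm_gt0 subr_eq0.
apply/ler_addgt0Pr => eta eta0.
have /nbhs_eballP[r r0 hr] := h _ (divr_gt0 eta0 N0).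
pose t : R := Num.min (1 / 2) (r / enorm (x - u)).
have t0 : 0 < t by rewrite lt_min !divr_gt0.
have t1 : t < 1 by rewrite gt_min; apply/orP; left; lra.
have tN : t * enorm (x - u) <= r.
  by rewrite -ler_pdivlMr// ge_min lexx orbT.
have xtE : t *: x + (1 - t) *: u - u = t *: (x - u).
  by apply/rowP => i; rewrite !mxE; ring.
have /hr/= : eball u r (t *: x + (1 - t) *: u).
  by rewrite /eball/= xtE enormZ gtr0_norm.
have := fc x u t I I; rewrite t0 t1 fx fu -!EFinM -EFinD => /(_ isT) h2.
move=> /le_trans/(_ h2); rewrite lee_fin xtE dotZr enormZ gtr0_norm//.
rewrite [_ * (t * _)]mulrCA divfK ?gt_eqF// => h3.
by rewrite -(ler_pM2l t0); lra.
Qed.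

(** The global inequalities at the approximating pairs pass to the limit because the values
    [f (x_ k)] converge to [f u]. *)
Lemma convex_limiting_subdiff f u v : proper_fun f ->
  econvex_on setT f -> limiting_subdiff f u v ->
  exists a, quad_support f 0 a u v.
Proof.
move=> fp fc [ud [x_ [v_ [xu fxu xv vv]]]].
have [fNy _] := fp.
have [a fu] := edom_fin fp ud; exists a; split=> // x.
rewrite mul0r subr0; apply: EFin_le_of_fin => // b fx.
rewrite fu in fxu.
have /= := fine_cvg fxu => cf.
have c1 : (fun k => fine (f (x_ k)) + dot (v_ k) (x - x_ k)) @ \oo --> a + dot v (x - u).
  apply: cvgD; [exact: cf|apply: (cvg_dot _ vv)].
  by apply: cvgB => //; exact: cvg_cst.
apply: (cvgr_to_le c1); apply: nearW => k.
have [c fk] := edom_fin fp (proj1 (xv k)).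
have [_ /(_ x)] := convex_regular_subdiff fNy fc fk (xv k).
by rewrite fk fx lee_fin mul0r subr0.
Qed.

(** A level [c] strictly between [a - h x] and [f x] splits the claim: near [x], both [f > c] and
    [h > a - c]. *)
Lemma lower_semicontinuousD_cts f (h : E -> R) :
  (forall x, (-oo < f x)%E) -> lower_semicontinuous f -> continuous h ->
  lower_semicontinuous (fun x => f x + (h x)%:E)%E.
Proof.
move=> fNy flsc hc x a afh.
have [c ac cf] : exists2 c : R, a - h x < c & (c%:E < f x)%E.
  move: afh (fNy x); case: (f x) => [b||]//.
    rewrite -EFinD lte_fin => ab _; exists ((a - h x + b) / 2); [lra|].
    by rewrite lte_fin; lra.
  by move=> _ _; exists (a - h x + 1); [lra|rewrite ltry].
have [V xV hV] := flsc x c cf.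
have hn : \forall y \near x, a - c < h y.
  by apply: (cvgr_gt (h x) (hc x)); lra.
exists (V `&` [set y | a - c < h y]); first exact: filterI.
move=> y [/hV + /= hy]; move: (fNy y); case: (f y) => [b||]// _ cb.
  by move: cb; rewrite -EFinD !lte_fin; lra.
by rewrite /= ltry.
Qed.

(** If the infimum over [A] is not attained, each point of [A] has a neighborhood where [g] exceeds
    some level above the infimum. Compactness provides one such level for all of [A], a
    contradiction. *)
Lemma lsc_compact_min g (A : set E) c : compact A -> A !=set0 ->
  lower_semicontinuous g -> (forall x, A x -> (c%:E <= g x)%E) ->
  exists2 u, A u & forall x, A x -> (g u <= g x)%E.
Proof.
move=> Ac [x0 Ax0] glsc gc; apply: contrapT => /forall2NP nmin.
pose m := ereal_inf (g @` A).
have mlt x : A x -> (m < g x)%E.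
  move=> Ax; have [//|/existsNP[y /not_implyP[Ay /negP]]] := nmin x.
  rewrite -ltNge => yx; apply: le_lt_trans yx.
  by apply: ereal_inf_lbound; exists y.
have mc : (c%:E <= m)%E by apply: le_ereal_inf_tmp => _ [x Ax <-]; exact: gc.
have [b mb] : exists b, m = b%:E.
  case: (m) (mlt _ Ax0) mc => [b _ _|+ _|]//; first by exists b.
  by rewrite ltNge leey.
have hN : \forall d \near b^'+, A `<=` (fun x => d%:E < g x)%E.
  move/compact_near_coveringP : Ac; apply.
  move=> x /mlt; rewrite mb => bx.
  have [d bd dx] : exists2 d : R, b < d & (d%:E < g x)%E.
    move: bx; case: (g x) => [e||]//.
      rewrite lte_fin => be; exists ((b + e) / 2); [lra|rewrite lte_fin; lra].
    by move=> _; exists (b + 1); [lra|rewrite ltry].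
  have [V xV hV] := glsc x d dx.
  exists (V, [set e | e < d]); first by split=> //=; exact: nbhs_right_lt.
  by move=> [y e] /= [/hV + ed]; apply: le_lt_trans; rewrite lee_fin ltW.
have [e [be he]] := filter_ex (filterI (nbhs_right_gt b) hN).
have : (e%:E <= m)%E by apply: le_ereal_inf_tmp => _ [x /he/ltW ex <-].
by rewrite mb lee_fin leNgt be.
Qed.

End Subgradients.

(** * Existence, stability and envelope value of proximal points *)

Section Proximal.
Context {R : realType} {n : nat}.
Local Notation E := 'rV[R]_n.
Implicit Types (f g : E -> \bar R) (u v w x y z : E) (a b c K l : R).

(** Since [K < 1 / (2 l)], adding the proximal quadratic to [f] gives a coercive function. For a
    minimizer [u], the vector [v = (z - u) / l] turns minimality into the support inequality. *)
Lemma prox_exists f K a u0 v0 l z : (forall x, (-oo < f x)%E) ->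
  lower_semicontinuous f -> quad_support f K a u0 v0 -> 0 < l ->
  K < (2 * l)^-1 ->
  exists u v b, z = u + l *: v /\ quad_support f (2 * l)^-1 b u v.
Proof.
move=> fNy flsc [fu0 h0] l0.
have : 2 * l * (2 * l)^-1 = 1 by rewrite mulfV// mulf_neq0// gt_eqF.
move: (2 * l)^-1 => s sl Ks.
pose g y := (f y + (s * dot (y - z) (y - z))%:E)%E.
(* [p] is the slope at [u0] of the quadratic lower bound of [g], and [c0] is [g u0]. Beyond distance
   [rho] the growth [s - K] outweighs the slope, so [g] is at least [c0] there. *)
pose p := v0 + (2 * s) *: (u0 - z).
pose c0 := a + s * dot (u0 - z) (u0 - z).
have sK : 0 < s - K by rewrite subr_gt0.
pose rho := enorm p / (s - K).
have rho0 : 0 <= rho by rewrite divr_ge0 ?enorm_ge0// ltW.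
have rhoE : (s - K) * rho = enorm p by rewrite mulrC divfK// gt_eqF.
have gle y : ((c0 - enorm p * enorm (y - u0)
    + (s - K) * enorm (y - u0) ^+ 2)%:E <= g y)%E.
  rewrite /g; have := h0 y; case: (f y) => [b||]//; last first.
    by move=> _; rewrite /= leey.
  rewrite -EFinD !lee_fin => hb.
  have yz : y - z = (y - u0) + (u0 - z) by rewrite subrKA.
  have := dot_le_enorm (- p) (y - u0).
  rewrite enormN sqr_enorm yz /c0 dotNl; move: hb.
  rewrite (_ : dot p _ = dot v0 (y - u0) + 2 * s * dot (u0 - z) (y - u0));
    last by rewrite /p dotDl dotZl.
  move: (enorm p) (y - u0) (u0 - z) => N h q.
  by rewrite !dotE (dotC q h); lra.
(* A cube of half-side [rho] is compact as a product of segments; a point outside it is at Euclidean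
   distance at least [rho] from [u0]. *)
pose A := [set y : E | forall i, [set` `[u0 0 i - rho, u0 0 i + rho]] (y 0 i)].
have Ac : compact A.
  apply: (@rV_compact R n (fun i => [set` `[u0 0 i - rho, u0 0 i + rho]])) => i.
  exact: segment_compact.
have Au0 : A u0.
  move=> i /=; rewrite in_itv/=; lra.
have gA y : ~ A y -> (c0%:E <= g y)%E.
  move=> /existsNP[i /= /negP]; rewrite in_itv/= => hi.
  have hy : rho <= enorm (y - u0).
    apply: le_trans (coord_le_enorm _ i); rewrite leNgt; apply/negP => hlt.
    by move: hlt hi; rewrite !mxE ltr_norml; lra.
  apply: le_trans (gle y); rewrite lee_fin.
  have : 0 <= (s - K) * enorm (y - u0) * (enorm (y - u0) - rho).
    by rewrite !mulr_ge0 ?subr_ge0 ?enorm_ge0// ltW.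
  by rewrite -rhoE; lra.
have gc y : ((c0 - enorm p * rho)%:E <= g y)%E.
  have [hy|hy] := leP (enorm (y - u0)) rho.
    apply: le_trans (gle y); rewrite lee_fin.
    have := enorm_ge0 p; have := enorm_ge0 (y - u0).
    have : 0 <= (s - K) * enorm (y - u0) ^+ 2 by rewrite mulr_ge0 ?sqr_ge0// ltW.
    nra.
  apply: le_trans (gle y); rewrite lee_fin.
  have : 0 <= (s - K) * enorm (y - u0) * (enorm (y - u0) - rho).
    by rewrite !mulr_ge0 ?subr_ge0 ?enorm_ge0// ltW.
  have := enorm_ge0 p; rewrite -rhoE; nra.
have glsc : lower_semicontinuous g.
  apply: lower_semicontinuousD_cts => // y.
  have yz : (fun t : E => t - z) @ nbhs y --> y - z.
    by apply: cvgB => //; exact: cvg_cst.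
  have yy := cvg_dot (nbhs_filter y) yz yz.
  exact: (cvgM (cvg_cst s) yy).
have [u Au umin] := lsc_compact_min Ac (ex_intro _ u0 Au0) glsc (fun y _ => gc y).
have gu0 : g u0 = c0%:E by rewrite /g fu0.
have gu x : (g u <= g x)%E.
  have [/umin//|/gA] := pselect (A x).
  by apply: le_trans; rewrite -gu0; exact: umin.
have [b fu] : exists b, f u = b%:E.
  have := gu u0; rewrite gu0 /g; move: (fNy u); case: (f u) => [b||]//.
  by exists b.
have lE : l * l^-1 = 1 by rewrite mulfV// gt_eqF.
exists u, (l^-1 *: (z - u)), b; split.
  by rewrite scalerA lE scale1r addrC subrK.
split=> // x; apply: EFin_le_of_fin => // c fx.
have := gu x; rewrite /g fu fx -!EFinD lee_fin.
have -> : x - z = (x - u) + (u - z) by rewrite subrKA.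
rewrite -(opprB u z); move: (u - z) (x - u) => q h.
have -> : l^-1 = 2 * s by apply: (mulfI (lt0r_neq0 l0)); rewrite lE; lra.
by rewrite !dotE (dotC q h); lra.
Qed.

(** Continuity of the proximal map at the reference pair. Adding the two support inequalities bounds
    [dot (v - v0) (u - u0)] below by [- (K + s) * enorm (u - u0) ^+ 2]. As [l * s = 1 / 2], the
    displacement [w] of [u + l *: v] then controls [u - u0] with factor [k = 1 / 2 - l * K], and
    hence also [v - v0]. *)
Lemma prox_near f K a u0 v0 l eta : quad_support f K a u0 v0 -> 0 < l ->
  K < (2 * l)^-1 -> 0 < eta ->
  exists2 delta : R, 0 < delta & forall u v b,
    quad_support f (2 * l)^-1 b u v ->
    eball (u0 + l *: v0) delta (u + l *: v) ->
    [/\ eball u0 eta u, eball v0 eta v & b < a + eta].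
Proof.
move=> q0 l0.
have : 2 * l * (2 * l)^-1 = 1 by rewrite mulfV// mulf_neq0// gt_eqF.
have : 0 < (2 * l)^-1 by rewrite invr_gt0 mulr_gt0.
move: (2 * l)^-1 => s s0 sl Ks eta0.
pose k := 1 / 2 - l * K; have k0 : 0 < k.
  have : l * K < l * s by rewrite ltr_pM2l.
  by rewrite /k; lra.
(* [tau] will bound both [enorm (u - u0)] and [enorm (v - v0)]. The support inequality at [u] then
   gives [b - a <= tau * (enorm v0 + s + 1)], strictly below [tau * M <= eta]. *)
pose M := enorm v0 + s + 2; have M0 : 2 < M.
  by rewrite /M; have := enorm_ge0 v0; lra.
pose tau := Num.min 1 eta / M.
have m0 : 0 < Num.min 1 eta by rewrite lt_min ltr01.
have tau0 : 0 < tau by rewrite divr_gt0// (lt_trans _ M0).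
have [tau1 taue] : tau * M <= 1 /\ tau * M <= eta.
  by rewrite divfK ?gt_eqF ?(lt_trans _ M0)// !ge_min !lexx orbT.
move: tau tau0 tau1 taue => tau tau0 tau1 taue.
(* The first bound yields [enorm (u - u0) <= tau]; the second yields [enorm (v - v0) <= tau] through
   [l * enorm (v - v0) <= enorm w + enorm (u - u0)]. *)
pose delta := Num.min (k * tau) (k * l * tau / (k + 1)).
have k1 : 0 < k + 1 by rewrite addr_gt0.
have d0 : 0 < delta by rewrite lt_min divr_gt0 ?mulr_gt0.
have d1 : delta <= k * tau by rewrite ge_min lexx.
have d2 : delta * (k + 1) <= k * l * tau.
  by rewrite -ler_pdivlMr// ge_min lexx orbT.
exists delta => // u v b q; rewrite /eball/=.
set w := _ - _ => hw.
have [fu _] := q; have [fu0 _] := q0.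
have h1 : a + dot v0 (u - u0) - K * dot (u - u0) (u - u0) <= b.
  by apply: (quad_support_real q0); rewrite fu.
have h2 : b + dot v (u0 - u) - s * dot (u0 - u) (u0 - u) <= a.
  by apply: (quad_support_real q); rewrite fu0.
move: h2; rewrite -(opprB u u0) dotNr dotNl dotNr opprK => h2.
have wE : w = (u - u0) + l *: (v - v0).
  by apply/rowP => i; rewrite !mxE; ring.
have vd : dot v (u - u0) = dot v0 (u - u0) + dot (v - v0) (u - u0).
  by rewrite -dotDl subrKC.
have wd : dot w (u - u0) = enorm (u - u0) ^+ 2 + l * dot (v - v0) (u - u0).
  by rewrite wE dotDl dotZl sqr_enorm.
have evE : l * enorm (v - v0) <= enorm w + enorm (u - u0).
  rewrite -[X in X * _](gtr0_norm l0) -enormZ.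
  have -> : l *: (v - v0) = w + - (u - u0) by rewrite wE [RHS]addrC addKr.
  by rewrite -(enormN (u - u0)); exact: ler_enormD.
have := dot_le_enorm w (u - u0).
have := enorm_ge0 (u - u0); have := enorm_ge0 (v - v0).
have := dot_le_enorm v0 (u - u0); have := dot_le_enorm (v - v0) (u - u0).
move: h1 h2 hw evE; rewrite -!sqr_enorm vd wd.
move: (dot v0 _) (dot (v - v0) _) => p q'.
rewrite /eball/=; move: (enorm (u - u0)) (enorm (v - v0)) (enorm w) => d e N.
move=> h1 h2 hN evE qe pd e0 e1 h3.
have kd : k * d <= N.
  have [d_gt0|d_le0] := ltP 0 d.
    rewrite -(ler_pM2r d_gt0); apply: le_trans h3; rewrite /k.
    have : l * (- q') <= l * ((K + s) * d ^+ 2) by rewrite ler_pM2l//; lra.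
    have : l * s * d ^+ 2 = 1 / 2 * d ^+ 2 by congr (_ * _); lra.
    by lra.
  have d00 : d = 0 by apply/eqP; rewrite eq_le d_le0.
  by move: evE; rewrite d00 addr0 mulr0; apply: le_trans; rewrite mulr_ge0// ltW.
have dtau : d <= tau by rewrite -(ler_pM2l k0); lra.
have etau : e <= tau.
  rewrite -(ler_pM2l (mulr_gt0 k0 l0)); apply: le_trans d2.
  have : k * (l * e) <= k * (N + d) by rewrite ler_pM2l.
  have : N * (k + 1) <= delta * (k + 1) by rewrite ler_pM2r.
  by lra.
have tau_half : tau * 2 <= tau * M by rewrite ler_pM2l// ltW.
split; [by lra|by lra|].
have : s * d ^+ 2 <= s * (tau * 1).
  by rewrite ler_pM2l// expr2 ler_pM//; lra.
have : e * d <= tau * 1 by rewrite ler_pM//; lra.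
have : enorm v0 * d <= enorm v0 * tau by rewrite ler_wpM2l ?enorm_ge0.
by rewrite /M in taue; lra.
Qed.

Lemma moreau_le f l x y c : (f y <= c%:E)%E ->
  (moreau_envelope l f x <= (c + (2 * l)^-1 * dot (y - x) (y - x))%:E)%E.
Proof.
move=> fy; apply: le_trans (ereal_inf_lbound (ex_intro2 _ _ y I erefl)) _.
by rewrite EFinD sqr_enorm leeD2r.
Qed.

(** Completing the square turns the support inequality into minimality of [u] in the infimum
    defining the envelope; the penalty at [u] is [l / 2 * dot v v]. *)
Lemma moreau_prox f l b u v : 0 < l -> quad_support f (2 * l)^-1 b u v ->
  moreau_envelope l f (u + l *: v) = (b + l / 2 * dot v v)%:E.
Proof.
move=> l0 [fu h].
have : 2 * l * (2 * l)^-1 = 1 by rewrite mulfV// mulf_neq0// gt_eqF.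
move=> sl; apply/eqP; rewrite eq_le; apply/andP; split.
  apply: (le_trans (@moreau_le _ _ _ u b _)); first by rewrite fu.
  rewrite lee_fin opprD addNKr dotNl dotNr opprK !dotE.
  have -> : (2 * l)^-1 * (l * (l * dot v v)) = l / 2 * dot v v; last by [].
  by field; rewrite gt_eqF.
apply: le_ereal_inf_tmp => _ [x _ <-].
have := h x; case: (f x) => [c||]//; last by move=> _; rewrite /= leey.
rewrite -EFinD !lee_fin sqr_enorm.
have -> : x - (u + l *: v) = (x - u) - l *: v by rewrite opprD addrA.
move: (x - u) (2 * l)^-1 sl => d s sl.
have slE t : s * (l * t) = t / 2.
  have : 2 * l * s * t = t by rewrite sl mul1r.
  by lra.
have := slE (dot v d); have := slE (l * dot v v).
by rewrite !dotE (dotC d v); lra.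
Qed.

End Proximal.

(** * From local prox-regularity to global quadratic supports *)

Section VariationalConvexity.
Context {R : realType} {n : nat}.
Local Notation E := 'rV[R]_n.
Implicit Types (f phi psi : E -> \bar R) (u v w x y z : E) (a b c K l : R).

(** A lower bound on the envelope at one point is a quadratic minorant centered there. Recentering
    at [x0] uses [|p + q|^2 <= 2 |p|^2 + 2 |q|^2], whence the factors 2. *)
Lemma prox_bounded_minorant phi x0 : (forall x, (-oo < phi x)%E) ->
  prox_bounded phi ->
  exists alpha beta : R, [/\ 0 <= alpha, 0 <= beta & forall y,
    ((- beta - alpha * enorm (y - x0) ^+ 2)%:E <= phi y)%E].
Proof.
move=> pNy [l l0 [x ex]].
have [m hm] : exists m : R, (m%:E <= moreau_envelope l phi x)%E.
  case: (moreau_envelope l phi x) ex => [m _|_|]//; first by exists m.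
  by exists 0; rewrite leey.
pose s := (2 * l)^-1.
have s0 : 0 < s by rewrite invr_gt0 mulr_gt0.
exists (2 * s), (`|m| + 2 * s * enorm (x0 - x) ^+ 2).
have s2 : 0 <= 2 * s by rewrite mulr_ge0 ?ltW.
split=> [//||y]; first by rewrite addr_ge0// mulr_ge0// sqr_ge0.
apply: EFin_le_of_fin => // b py.
have := le_trans hm (ereal_inf_lbound (ex_intro2 _ _ y I erefl)).
rewrite /= py -EFinD lee_fin -/s.
have -> : y - x = (y - x0) + (x0 - x) by rewrite subrKA.
have : 0 <= s * dot ((y - x0) - (x0 - x)) ((y - x0) - (x0 - x)).
  by rewrite mulr_ge0 ?dot_ge0// ltW.
rewrite !sqr_enorm; move: (y - x0) (x0 - x) => p q.
rewrite !dotE (dotC q p).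
by have := ler_norm (- m); rewrite normrN; lra.
Qed.

(** Within distance [e] of [x0] prox-regularity applies. Farther away, restricting [u] to radius
    [e / 2] keeps [D = enorm (x - u)] at least [e / 2], so a large multiple of [D ^+ 2] absorbs the
    rest. *)
Lemma prox_regular_global phi x0 v0 : proper_fun phi -> edom phi x0 ->
  prox_bounded phi -> prox_regular phi x0 v0 ->
  exists eps K : R, [/\ 0 < eps, 0 <= K & forall u v,
    limiting_subdiff phi u v -> eball x0 eps u -> eball v0 eps v ->
    (phi u < phi x0 + eps%:E)%E ->
    exists b, quad_support phi K b u v].
Proof.
move=> pp px pb [e [r [e0 r0 H]]].
have [pNy _] := pp; have [a pa] := edom_fin pp px.
have [alpha [beta [al0 be0 hmin]]] := prox_bounded_minorant x0 pNy pb.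
(* The terms of [K] absorb, in order, the constants, the quadratic minorant, the linear term ([M]
   bounds [enorm v]) and the prox-regularity modulus. Each factor [2 / e] comes from
   [1 <= 2 / e * D]. *)
pose C := `|a + e + beta|; pose M := enorm v0 + e.
pose K := C * (2 / e) ^+ 2 + 4 * alpha + M * (2 / e) + r / 2.
have M0 : 0 <= M by rewrite addr_ge0 ?enorm_ge0// ltW.
have ie0 : 0 < 2 / e by rewrite divr_gt0.
have K1 : 0 <= C * (2 / e) ^+ 2 by rewrite mulr_ge0 ?normr_ge0 ?sqr_ge0.
have K2 : 0 <= M * (2 / e) by rewrite mulr_ge0// ltW.
have K0 : 0 <= K by rewrite /K; lra.
have e2 : 0 < e / 2 by rewrite divr_gt0.
exists (e / 2), K; split=> // u v uv ue ve pu.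
have [b pub] := edom_fin pp (proj1 uv).
exists b; split=> // x.
have ue' : eball x0 e u by apply: le_trans ue _; lra.
have ve' : eball v0 e v by apply: le_trans ve _; lra.
have bae : b < a + e.
  by move: pu; rewrite pub pa -EFinD lte_fin; lra.
have [xe|xe] := leP (enorm (x - x0)) e.
  have := H x u v xe (conj uv (conj ue' ve')).
  rewrite pub pa -EFinD lte_fin => /(_ bae).
  apply: le_trans; rewrite -EFinD lee_fin addrA sqr_enorm.
  rewrite lerD2l lerN2 ler_wpM2r ?dot_ge0//.
  by rewrite /K; lra.
apply: le_trans (hmin x); rewrite lee_fin.
have D1 : enorm (x - x0) <= enorm (x - u) + e / 2.
  apply: (le_trans (ler_dist_enormD u _ _)); rewrite lerD2l; exact: ue.
have D2 : e / 2 <= enorm (x - u) by lra.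
have vM : enorm v <= M.
  rewrite -(subrK v0 v); apply: le_trans (ler_enormD _ _) _.
  by rewrite addrC lerD2l.
have := dot_le_enorm v (x - u).
rewrite -sqr_enorm; move: (enorm (x - u)) (enorm (x - x0)) D1 D2 xe => D d D1 D2 xe dv.
have D0 : 0 < D by lra.
have q1 : 1 <= 2 / e * D by rewrite mulrAC ler_pdivlMr//; lra.
have h1 : dot v (x - u) <= M * (2 / e) * D ^+ 2.
  apply: (le_trans dv); rewrite expr2 mulrACA.
  apply: (@le_trans _ _ (M * D)); first by rewrite ler_pM2r.
  by rewrite ler_peMr// mulr_ge0// ltW.
have h2 : alpha * d ^+ 2 <= 4 * alpha * D ^+ 2.
  have -> : 4 * alpha * D ^+ 2 = alpha * (D + D) ^+ 2 by ring.
  by rewrite ler_wpM2l// ler_sqr ?nnegrE; lra.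
have h3 : a + e + beta <= C * (2 / e) ^+ 2 * D ^+ 2.
  apply: (le_trans (ler_norm _)); rewrite -/C -mulrA -exprMn.
  by rewrite ler_peMr ?normr_ge0// exprn_ege1.
have h4 : 0 <= r / 2 * D ^+ 2 by rewrite mulr_ge0 ?divr_ge0 ?sqr_ge0.
by rewrite /K; lra.
Qed.

End VariationalConvexity.

(** * Variational convexity implies prox-regularity and convex envelopes *)

Section Forward.
Context {R : realType} {n : nat}.
Local Notation E := 'rV[R]_n.
Context (phi : E -> \bar R) (x0 v0 : E) (pp : proper_fun phi)
  (px : edom phi x0) (pv : limiting_subdiff phi x0 v0)
  (pvc : variationally_convex phi x0 v0).

(** One radius [r] serves for both neighborhoods and for the value cutoff. Pairs of the graph of
    [psi] need no cutoff, since equality of the localized graphs supplies it. *)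
Lemma variationally_convex_eball : exists (psi : E -> \bar R) (r : R),
  [/\ 0 < r, proper_fun psi, lower_semicontinuous psi & econvex_on setT psi] /\
  [/\ forall x, eball x0 r x -> (psi x <= phi x)%E,
      limiting_subdiff psi x0 v0,
      phi x0 = psi x0,
      forall u v, limiting_subdiff phi u v -> eball x0 r u -> eball v0 r v ->
        (phi u < phi x0 + r%:E)%E -> limiting_subdiff psi u v /\ phi u = psi u &
      forall u v, limiting_subdiff psi u v -> eball x0 r u -> eball v0 r v ->
        limiting_subdiff phi u v /\ phi u = psi u].
Proof.
have [a pa] := edom_fin pp px.
case: pvc => U [V [[nU _ nV _] [psi [eps /= [[psip psil psic] le e0 cE ce]]]]].
have [r1 r10 r1U] := nbhs_eballP nU; have [r2 r20 r2V] := nbhs_eballP nV.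
pose r := Num.min eps (Num.min r1 r2).
have [re rr1 rr2] : [/\ r <= eps, r <= r1 & r <= r2].
  by rewrite /r !ge_min !lexx !orbT.
have rU x : eball x0 r x -> U x by move=> h; apply: r1U; exact: le_trans h _.
have rV v : eball v0 r v -> V v by move=> h; apply: r2V; exact: le_trans h _.
have H u v : limiting_subdiff phi u v -> U u -> V v ->
    (phi u < phi x0 + eps%:E)%E -> limiting_subdiff psi u v /\ phi u = psi u.
  move=> uv Uu Vv lt.
  have cm : ([set x | U x /\ (phi x < phi x0 + eps%:E)%E] `*` V `&`
    gph (limiting_subdiff phi)) (u, v) by [].
  by split; [move: (cm); rewrite cE => -[]|exact: ce cm].
have [psiv psix] : limiting_subdiff psi x0 v0 /\ phi x0 = psi x0.
  apply: H => //; [exact: nbhs_singleton nU|exact: nbhs_singleton nV|].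
  by rewrite pa -EFinD lte_fin ltrDl.
exists psi, r; split; first by split=> //; rewrite !lt_min e0 r10 r20.
split=> //.
- by move=> x /rU/le.
- move=> u v uv /rU Uu /rV Vv lt; apply: H => //.
  by apply: lt_le_trans lt _; rewrite leeD2l// lee_fin.
- move=> u v uv /rU Uu /rV Vv.
  have : (U `*` V `&` gph (limiting_subdiff psi)) (u, v) by [].
  by rewrite -cE => cm; split; [case: cm|exact: ce cm].
Qed.

(** Modulus [0] works: nearby subgradients of [phi] are subgradients of the convex [psi], whose
    affine minorants lie below [phi] on the ball. *)
Lemma variationally_convex_prox_regular : prox_regular phi x0 v0.
Proof.
have [psi [r [[r0 psip psil psic] [le _ _ H _]]]] := variationally_convex_eball.
exists r, 0; split=> // x u v xr [uv [/= ur vr]] lt.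
have [psiv pu] := H u v uv ur vr lt.
have [b [psib psile]] := convex_limiting_subdiff psip psic psiv.
rewrite pu psib -EFinD; apply: le_trans (le x xr).
by apply: le_trans (psile x); rewrite !mul0r !subr0.
Qed.

Lemma variationally_convex_moreau : prox_bounded phi ->
  exists2 lambda0 : R, 0 < lambda0 & forall lambda : R, 0 < lambda < lambda0 ->
    locally_convex_around (moreau_envelope lambda phi) (x0 + lambda *: v0).
Proof.
move=> pb; have [pNy _] := pp; have [a pa] := edom_fin pp px.
have [eps [K [e0 K0 HK]]] :=
  prox_regular_global pp px pb variationally_convex_prox_regular.
have [psi [r [[r0 psip psil psic] [_ psiv psix _ H]]]] :=
  variationally_convex_eball.
have [psiNy _] := psip.
have [a' q0] := convex_limiting_subdiff psip psic psiv.
have aa' : a' = a by case: q0; rewrite -psix pa => -[].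
rewrite {}aa' in q0.
(* Below this threshold [1 / (2 l)] exceeds [K + 1], so the global supports of [phi] with constant
   [K] yield proximal points. *)
exists (2 * (K + 1))^-1; first by rewrite invr_gt0; lra.
move=> l /andP[l0 lK].
have s0 : 0 < (2 * l)^-1 by rewrite invr_gt0 mulr_gt0.
have Ks : K < (2 * l)^-1.
  have : 2 * l < (K + 1)^-1 by move: lK; rewrite invfM; lra.
  rewrite -ltf_pV2 ?posrE ?invr_gt0 ?mulr_gt0//; last lra.
  by rewrite invrK; lra.
pose eta := Num.min eps r.
have [ee er] : eta <= eps /\ eta <= r by rewrite /eta !ge_min !lexx orbT.
have eta0 : 0 < eta by rewrite lt_min e0.
have [delta d0 near] := prox_near q0 l0 s0 eta0.
have prox z : eball (x0 + l *: v0) delta z -> exists u v b,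
    [/\ z = u + l *: v, quad_support psi (2 * l)^-1 b u v &
      quad_support phi (2 * l)^-1 b u v].
  move=> zd; have [u [v [b [zE qu]]]] := prox_exists z psiNy psil q0 l0 s0.
  rewrite zE in zd; have [ue ve be] := near u v b qu zd.
  exists u, v, b; split=> //.
  have [||phiuv puv] := H u v (quad_support_limiting psiNy qu).
  - exact: le_trans ue _.
  - exact: le_trans ve _.
  have pub : phi u = b%:E by rewrite puv; case: qu.
  have [|||b' q'] := HK u v phiuv.
  - exact: le_trans ue _.
  - exact: le_trans ve _.
  - by rewrite pub pa -EFinD lte_fin; lra.
  have bb' : b' = b by case: q'; rewrite pub => -[].
  by apply: (quad_supportW (ltW Ks)); rewrite -bb'.
exists (eball (x0 + l *: v0) delta); split; first exact: nbhs_eball.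
  exact: convex_eball.
move=> z1 z2 t z1d z2d /andP[t0 t1].
have [u [v [b [zE qpsi qphi]]]] : exists u v b,
    [/\ t *: z1 + (1 - t) *: z2 = u + l *: v,
      quad_support psi (2 * l)^-1 b u v &
      quad_support phi (2 * l)^-1 b u v].
  by apply/prox/eball_conv => //; rewrite !ltW.
have [u1 [v1 [b1 [z1E [psi1 _] q1]]]] := prox _ z1d.
have [u2 [v2 [b2 [z2E [psi2 _] q2]]]] := prox _ z2d.
(* At the convex combination the envelope of [phi] is exchanged for that of [psi], so that the
   combination of [u1] and [u2] can be used as a trial point and estimated by convexity of [psi]. *)
rewrite zE (moreau_prox l0 qphi) -(moreau_prox l0 qpsi) -zE.
rewrite z1E z2E (moreau_prox l0 q1) (moreau_prox l0 q2).
have cy : (psi (t *: u1 + (1 - t) *: u2)%R <= (t * b1 + (1 - t) * b2)%:E)%E.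
  have := psic u1 u2 t I I; rewrite t0 t1 psi1 psi2 => /(_ isT).
  by rewrite -!EFinM -EFinD.
apply: le_trans (moreau_le l _ cy) _.
rewrite -!EFinM -EFinD lee_fin.
have -> : t *: u1 + (1 - t) *: u2 - (t *: (u1 + l *: v1) + (1 - t) *: (u2 + l *: v2))
    = - (l *: (t *: v1 + (1 - t) *: v2)).
  by apply/rowP => i; rewrite !mxE; ring.
(* This is the convexity gap of [l / 2 * dot v v] between [v1] and [v2]. *)
have t1' : 0 <= t * (1 - t) * (l / 2) * dot (v1 - v2) (v1 - v2).
  by rewrite !mulr_ge0 ?dot_ge0 ?invr_ge0// ?subr_ge0 ltW.
have sl y : (2 * l)^-1 * (l * (l * y)) = l / 2 * y by field; rewrite gt_eqF.
rewrite dotNl dotNr opprK dotZl dotZr sl.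
move: t1'; rewrite !dotE (dotC v2 v1); lra.
Qed.

End Forward.

(** * Convexity of one envelope implies variational convexity *)

Section Backward.
Context {R : realType} {n : nat}.
Local Notation E := 'rV[R]_n.
Implicit Types (f phi psi : E -> \bar R) (u v w x y z : E) (a b c K l r : R).

(** Using [u] as a trial point bounds the envelope above by a quadratic that is exact at
    [u + l *: v] and has gradient [v] there. Convexity along the line through [z] turns this upper
    bound on the far side into a lower bound at [z], with an error vanishing with [t]. *)
Lemma moreau_gradient f l z0 r b u v z c : 0 < l -> 0 < r ->
  econvex_on (eball z0 r) (moreau_envelope l f) ->
  quad_support f (2 * l)^-1 b u v ->
  eball z0 (r / 2) (u + l *: v) -> eball z0 r z ->
  (moreau_envelope l f z <= c%:E)%E ->
  b + l / 2 * dot v v + dot v (z - (u + l *: v)) <= c.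
Proof.
move=> l0 r0 ec q hu hz ezc.
have s0 : 0 < (2 * l)^-1 by rewrite invr_gt0 mulr_gt0.
set d := z - _; set s := (2 * l)^-1 in s0.
have N0 : 0 < enorm d + 1 by rewrite ltr_wpDl ?enorm_ge0.
have D0 : 0 < s * dot d d + 1.
  by rewrite ltr_wpDl// mulr_ge0 ?dot_ge0// ltW.
apply/ler_addgt0Pr => eta eta0.
(* The first bound keeps [z'] in the ball; the second makes the second-order error [t * s * dot d d]
   at most [eta]. Adding 1 avoids a zero denominator. *)
pose t := Num.min (r / 2 / (enorm d + 1)) (eta / (s * dot d d + 1)).
have t0 : 0 < t by rewrite lt_min !divr_gt0.
have t1 : t * (enorm d + 1) <= r / 2 by rewrite -ler_pdivlMr// ge_min lexx.
have t2 : t * (s * dot d d + 1) <= eta.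
  by rewrite -ler_pdivlMr// ge_min lexx orbT.
have ti0 : 0 < 1 + t by rewrite addr_gt0.
pose tau := (1 + t)^-1; have tauE : tau * (1 + t) = 1 by rewrite mulVf ?gt_eqF.
have tau0 : 0 < tau by rewrite invr_gt0.
have tau1 : tau < 1 by rewrite invf_lt1// ltrDl.
(* The envelope is bounded by a quadratic at [z'], on the far side of the contact
   point [u + l *: v], which is a convex combination of [z'] and [z]. *)
pose z' := u + l *: v - t *: d.
have hz' : eball z0 r z'.
  rewrite /eball/= /z' addrAC; apply: le_trans (ler_enormD _ _) _.
  by rewrite enormN enormZ gtr0_norm//; move: hu; rewrite /eball/=; lra.
have zE : tau *: z' + (1 - tau) *: z = u + l *: v.
  have -> : 1 - tau = tau * t by lra.
  rewrite /z' /d; apply/rowP => i; rewrite !mxE.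
  rewrite -[RHS]mul1r -tauE; ring.
have e1 : (moreau_envelope l f z' <= (b + s * dot (u - z') (u - z'))%:E)%E.
  by apply: moreau_le; case: q => ->.
have := ec z' z tau hz' hz; rewrite tau0 tau1 => /(_ isT).
have p0 : (0 <= tau%:E)%E by rewrite lee_fin ltW.
have p1 : (0 <= (1 - tau)%:E)%E by rewrite lee_fin subr_ge0 ltW.
rewrite zE (moreau_prox l0 q).
move=> /le_trans/(_ (leeD (lee_wpmul2l p0 e1) (lee_wpmul2l p1 ezc))).
rewrite -!EFinM -EFinD lee_fin -(ler_pM2r ti0).
have -> : u - z' = - (l *: v - t *: d).
  by rewrite /z'; apply/rowP => i; rewrite !mxE; ring.
clear zE; clearbody d.
set X : R := b + s * _.
have -> : (tau * X + (1 - tau) * c) * (1 + t) =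
    tau * (1 + t) * X + ((1 + t) - tau * (1 + t)) * c by ring.
rewrite tauE mul1r [_ - 1]addrC addKr /X => h3.
have sl (y : R) : s * (l * y) = y / 2 by rewrite /s; field; rewrite gt_eqF.
move: h3; rewrite dotNl dotNr opprK !dotE (dotC d v) => h3.
have h1 := sl (l * dot v v); have h2 := sl (t * dot v d).
have h4 : t * (t * (s * dot d d + 1)) <= t * eta by rewrite ler_pM2l.
have h5 := mulr_gt0 t0 t0.
rewrite -(ler_pM2l t0).
lra.
Qed.

Lemma moreau_convex_variational phi x0 v0 : proper_fun phi ->
  lower_semicontinuous phi -> prox_bounded phi -> edom phi x0 ->
  limiting_subdiff phi x0 v0 -> prox_regular phi x0 v0 ->
  (exists2 lambda0 : R, 0 < lambda0 & forall lambda : R, 0 < lambda < lambda0 ->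
    locally_convex_around (moreau_envelope lambda phi) (x0 + lambda *: v0)) ->
  variationally_convex phi x0 v0.
Proof.
move=> pp plsc pb px pv pr [l1 l10 Hl].
have [pNy _] := pp; have [a pa] := edom_fin pp px.
have [eps [K [e0 K0 HK]]] := prox_regular_global pp px pb pr.
(* Halving the minimum gives [l < l1] strictly and [1 / (2 l) >= K + 1 > K]. *)
pose l := Num.min l1 (K + 1)^-1 / 2.
have K10 : 0 < (K + 1)^-1 by rewrite invr_gt0; lra.
have m0 : 0 < Num.min l1 (K + 1)^-1 by rewrite lt_min l10.
have [m1 m2] : Num.min l1 (K + 1)^-1 <= l1 /\ Num.min l1 (K + 1)^-1 <= (K + 1)^-1.
  by rewrite !ge_min !lexx orbT.
have l0 : 0 < l by rewrite divr_gt0.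
have ll1 : l < l1 by rewrite /l; lra.
have s0 : 0 < (2 * l)^-1 by rewrite invr_gt0 mulr_gt0.
have Ks : K < (2 * l)^-1.
  apply: (@lt_le_trans _ _ (K + 1)); first by lra.
  by rewrite -lef_pV2 ?posrE// ?invrK; [rewrite /l; lra|lra].
have [W [nW _ Wc]] := Hl l (introT andP (conj l0 ll1)).
have [r r0 rW] := nbhs_eballP nW.
have ec : econvex_on (eball (x0 + l *: v0) r) (moreau_envelope l phi).
  by move=> x y t /rW Wx /rW Wy; exact: Wc.
(* For [x] and [v] within [d1] of [x0] and [v0], the point [x + l *: v] lies in the half-radius ball
   required by [moreau_gradient]. *)
pose d1 := Num.min eps (r / 2 / (1 + l)).
have l10' : 0 < 1 + l by rewrite addr_gt0.
have [d1e d1r] : d1 <= eps /\ d1 * (1 + l) <= r / 2.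
  by rewrite -ler_pdivlMr// !ge_min !lexx orbT.
have d10 : 0 < d1 by rewrite lt_min e0 !divr_gt0.
pose G u v := [/\ limiting_subdiff phi u v, eball x0 d1 u, eball v0 d1 v &
  (phi u < phi x0 + eps%:E)%E].
have shift x v t : eball x0 t x -> eball v0 t v ->
    eball (x0 + l *: v0) (t * (1 + l)) (x + l *: v).
  rewrite /eball/= => hx hv.
  have -> : x + l *: v - (x0 + l *: v0) = (x - x0) + l *: (v - v0).
    by apply/rowP => i; rewrite !mxE; ring.
  apply: le_trans (ler_enormD _ _) _; rewrite enormZ gtr0_norm// mulrDr mulr1.
  by rewrite lerD// mulrC ler_pM2r.
have Gq u v : G u v -> exists b, quad_support phi K b u v.
  by move=> [uv ue ve lt]; apply: HK => //; exact: le_trans d1e.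
have Ginq u v b : G u v -> phi u = b%:E -> forall x, eball x0 d1 x ->
    ((b + dot v (x - u))%:E <= phi x)%E.
  move=> Guv pub x xd; apply: EFin_le_of_fin => // c pxc.
  have [b' q] := Gq _ _ Guv.
  have bb' : b' = b by case: q; rewrite pub => -[].
  have {}q := quad_supportW (ltW Ks) q; rewrite bb' in q.
  have [uv ue ve lt] := Guv.
  have e1 : (moreau_envelope l phi (x + l *: v) <= (c + l / 2 * dot v v)%:E)%E.
    have pxc' : (phi x <= c%:E)%E by rewrite pxc.
    apply: le_trans (moreau_le l (x + l *: v) pxc') _.
    rewrite lee_fin opprD addNKr dotNl dotNr opprK !dotE.
    have -> : (2 * l)^-1 * (l * (l * dot v v)) = l / 2 * dot v v; last by [].
    by field; rewrite gt_eqF.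
  have := moreau_gradient l0 r0 ec q (le_trans (shift _ _ _ ue ve) d1r) _ e1.
  rewrite opprD addrACA subrr addr0.
  move=> h; have : b + l / 2 * dot v v + dot v (x - u) <= c + l / 2 * dot v v.
    apply: h; apply: le_trans (shift _ _ _ xd ve) _; lra.
  by lra.
have Gx0 : G x0 v0.
  by split=> //; rewrite /eball/= ?subrr ?enorm0 ?ltW// pa -EFinD lte_fin ltrDl.
(* [fine] loses nothing here: by [Gq], [phi] is finite at the first component of every pair in
   [G]. *)
pose aff (p : E * E) x : R := fine (phi p.1) + dot p.2 (x - p.1).
pose psi x := ereal_sup [set (aff p x)%:E | p in [set p | G p.1 p.2]].
have psi_ge u v b x : G u v -> phi u = b%:E -> ((b + dot v (x - u))%:E <= psi x)%E.
  move=> Guv pub; apply: ereal_sup_ubound; exists (u, v) => //.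
  by rewrite /aff/= pub.
have psi_le x : eball x0 d1 x -> (psi x <= phi x)%E.
  move=> xd; apply: ge_ereal_sup => _ [[u v] /= Guv <-].
  have [b [pub _]] := Gq _ _ Guv.
  by rewrite /aff/= pub; exact: Ginq Guv pub x xd.
have Gpsi u v b : G u v -> phi u = b%:E -> quad_support psi 0 b u v.
  move=> Guv pub; split=> [|x]; last by rewrite mul0r subr0; exact: psi_ge.
  apply/eqP; rewrite eq_le; apply/andP; split.
    by rewrite -pub; apply: psi_le; case: Guv.
  by have := psi_ge _ _ _ u Guv pub; rewrite subrr dot0r addr0.
have psiNy x : (-oo < psi x)%E.
  by apply: lt_le_trans (psi_ge _ _ _ x Gx0 pa); rewrite ltNyr.
have psip : proper_fun psi.
  split=> //; exists x0; rewrite /edom/=.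
  by have [-> _] := Gpsi _ _ _ Gx0 pa; rewrite ltry.
have psic : econvex_on setT psi.
  move=> x y t _ _ /andP[t0 t1]; apply: ge_ereal_sup => _ [p Gp <-].
  have -> : aff p (t *: x + (1 - t) *: y) = t * aff p x + (1 - t) * aff p y.
    by rewrite /aff !dotE; ring.
  have p0 : (0 <= t%:E)%E by rewrite lee_fin ltW.
  have p1 : (0 <= (1 - t)%:E)%E by rewrite lee_fin subr_ge0 ltW.
  rewrite EFinD !EFinM.
  by apply: leeD; apply: lee_wpmul2l => //; apply: ereal_sup_ubound; exists p.
have psil : lower_semicontinuous psi.
  move=> x c /ereal_sup_gt[_ [p Gp <-]]; rewrite lte_fin => cp.
  have cva : aff p y @[y --> nbhs x] --> aff p x.
    apply: cvgD; first exact: cvg_cst.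
    apply: (cvg_dot (nbhs_filter x)); first exact: cvg_cst.
    by apply: cvgB => //; exact: cvg_cst.
  exists [set y | c < aff p y]; first exact: (cvgr_gt _ cva _ cp).
  move=> y /= cy; apply: (@lt_le_trans _ _ (aff p y)%:E); first by rewrite lte_fin.
  by apply: ereal_sup_ubound; exists p.
have u0q : quad_support phi K a x0 v0.
  by have [b q] := Gq _ _ Gx0; have := proj1 q; rewrite pa => -[->].
have [delta dl0 near] := prox_near u0q l0 Ks d10.
(* Pairs within [d2] have [u + l *: v] within [delta] of the reference point, so [near] places the
   proximal pair of that point in [G]. *)
pose d2 := Num.min d1 (delta / (1 + l)).
have [d21 d2d] : d2 <= d1 /\ d2 * (1 + l) <= delta.
  by split; rewrite -?ler_pdivlMr// ge_min lexx ?orbT.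
have d20 : 0 < d2 by rewrite lt_min d10 divr_gt0.
exists (eball x0 d2), (eball v0 d2); split.
  by split; [exact: nbhs_eball|exact: convex_eball|exact: nbhs_eball|exact: convex_eball].
exists psi, eps => /=.
have common_G u v : (([set x | eball x0 d2 x /\ (phi x < phi x0 + eps%:E)%E] `*`
    eball v0 d2) `&` gph (limiting_subdiff phi)) (u, v) -> G u v.
  by move=> [[[/= ud lt] vd] uv]; split=> //; exact: le_trans d21.
split=> //.
- by move=> x xd; apply: psi_le; exact: le_trans d21.
- apply/seteqP; split=> [] [u v] H.
    have Guv := common_G _ _ H; have [b [pub _]] := Gq _ _ Guv.
    move: H => [[[/= ud lt] vd] uv]; split=> //=.
    exact: quad_support_limiting (Gpsi _ _ _ Guv pub).
  move: H => [[/= ud vd] uv].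
  have [b q] := convex_limiting_subdiff psip psic uv.
  (* The point [u + l *: v] also decomposes through a pair [(u', v')] of [G]. Both pairs belong to
     the graph of the subdifferential of [psi], and monotonicity makes them equal. *)
  have [u' [v' [b' [zE q']]]] := prox_exists (u + l *: v) pNy plsc u0q l0 Ks.
  have [|ue ve be] := near u' v' b' q'.
    by rewrite -zE; apply: le_trans (shift _ _ _ ud vd) _.
  have pu' : phi u' = b'%:E by case: q'.
  have Guv' : G u' v'.
    split=> //; first exact: quad_support_limiting q'.
    by rewrite pu' pa -EFinD lte_fin; lra.
  have q2 := Gpsi _ _ _ Guv' pu'.
  have h1 : b + dot v (u' - u) - 0 * dot (u' - u) (u' - u) <= b'.
    by apply: (quad_support_real q); case: q2 => ->.
  have h2 : b' + dot v' (u - u') - 0 * dot (u - u') (u - u') <= b.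
    by apply: (quad_support_real q2); case: q => ->.
  have uu' : u' - u = l *: (v - v').
    by apply/eqP; rewrite scalerBr subr_eq addrAC eq_sym subr_eq addrC zE addrC.
  (* The sum of [h1] and [h2] says [dot (v - v') (u' - u) <= 0], while [u' - u = l *: (v - v')]. *)
  have vv' : v = v'.
    apply/eqP; rewrite -subr_eq0 -enorm_eq0 -sqrf_eq0 eq_le sqr_ge0 andbT.
    rewrite -(ler_pM2l l0) mulr0 sqr_enorm -dotZr -uu' dotDl dotNl.
    by move: h2; rewrite -(opprB u') dotNr; lra.
  move: uu'; rewrite vv' subrr scaler0 => /eqP; rewrite subr_eq0 => /eqP uu'.
  by move: ud vd; rewrite vv' -uu' => ud vd; case: Guv'.
- move=> u v /common_G Guv; have [b [pub _]] := Gq _ _ Guv.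
  by have [-> _] := Gpsi _ _ _ Guv pub.
Qed.

End Backward.

Theorem theorem3p2 (R : realType) (n : nat) (phi : 'rV[R]_n -> \bar R)
    (xbar vbar : 'rV[R]_n)
    (phi_proper : proper_fun phi)
    (phi_lsc : lower_semicontinuous phi)
    (phi_pb : prox_bounded phi)
    (xbar_dom : edom phi xbar)
    (vbar_sub : limiting_subdiff phi xbar vbar) :
  variationally_convex phi xbar vbar <->
  (prox_regular phi xbar vbar /\
   exists2 lambda0 : R, 0 < lambda0 &
     forall lambda : R, 0 < lambda < lambda0 ->
       locally_convex_around (moreau_envelope lambda phi) (xbar + lambda *: vbar)).
Proof.
split=> [vc|[pr mc]].
  split; first exact: variationally_convex_prox_regular.
  exact: variationally_convex_moreau.
exact: moreau_convex_variational.
Qed.
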